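(* For every integer $n\ge 1$ the following identities hold: (i) $\tau(n) = n^4\sigma(n) - 24\sum_{m=1}^{n-1} (35 m^4 -52 m^3n + 18 m^2 n^2)\sigma(m)\sigma(n-m)$; (ii) $\tau(n) = n^4(7\sigma(n) - 6 \sigma_3(n)) - 168\sum_{m=1}^{n-1} (5 m^4 - 4 m^3n)\sigma(m)\sigma(n-m)$; (iii) $\tau(n) = n^4\sigma_3(n) - 168\sum_{m=1}^{n-1} (5 m^4 - 8 m^3n + 3 m^2n^2)\sigma(m)\sigma(n-m)$; (iv) $\tau(n) = \frac{n^4}{3}(7\sigma(n) -4\sigma_3(n)) - 56\sum_{m=1}^{n-1} (15 m^4 - 20 m^3n + 6m^2n^2)\sigma(m)\sigma(n-m)$.
   Context: $\tau(n)$ is Ramanujan's tau function, defined by $q\prod_{n\ge 1}(1-q^n)^{24} = \sum_{n\ge 1}\tau(n)q^n$. For $k\ge 1$, $\sigma_k(n)=\sum_{d\mid n} d^k$ (sum over positive divisors of $n$), and $\sigma(n)=\sigma_1(n)$. For $n=1$ the sum $\sum_{m=1}^{n-1}$ is empty and equals $0$. *)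

(* Defs.v *)
From mathcomp Require Import all_boot all_order all_algebra.

Set Implicit Arguments.
Unset Strict Implicit.
Unset Printing Implicit Defensive.

Import Order.TTheory GRing.Theory Num.Theory.

Local Open Scope ring_scope.

Definition sigma (k n : nat) : nat := (\sum_(d <- divisors n) d ^ k)%N.

(* The formal product q * prod_(k >= 1) (1 - q^k)^24, truncated to k <= N,
   with q written 'X. *)
Definition delta_trunc (N : nat) : {poly int} :=
  'X * \prod_(1 <= k < N.+1) (1 - 'X^k) ^+ 24.

(* The coefficient of q^n in the infinite product. Factors with k > n do not
   contribute to it, so the partial products have a constant n-th coefficient
   from N = n on, see tau_stable. *)
Definition tau (n : nat) : int := (delta_trunc n)`_n.

Lemma tau_stable (n N : nat) : (n <= N)%N -> (delta_trunc N)`_n = tau n.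
Proof.
move=> /subnK <-; elim: (N - n)%N => [//|j IHj].
rewrite addSn -{}IHj; set M := (j + n)%N.
have [p ->] : exists p : {poly int},
    delta_trunc M.+1 = delta_trunc M + p * 'X^(M.+1).
  rewrite /delta_trunc big_nat_recr //= mulrA; set D := 'X * _.
  set y := 'X^(M.+1); exists (D * - \sum_(i < 24) (1 - y) ^+ i).
  have -> : (1 - y) ^+ 24 = 1 + (- \sum_(i < 24) (1 - y) ^+ i) * y.
    apply/eqP; rewrite [eqbRHS]addrC -subr_eq subrX1; apply/eqP.
    by rewrite addrAC subrr add0r !mulNr mulrC.
  by rewrite mulrDr mulr1 mulrA.
by rewrite coefD coefMXn ltnS leq_addl addr0.
Qed.

(* Main.v *)
Require Import Defs.
From HB Require Import structures.
From mathcomp Require Import all_boot all_order all_algebra.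
From mathcomp Require Import zify ring lra.

Set Implicit Arguments.
Unset Strict Implicit.
Unset Printing Implicit Defensive.

Import Order.TTheory GRing.Theory Num.Theory.

Local Open Scope ring_scope.

(* Write a sum over the positive solutions of n = a x + b y as a sum over
   x > y, x < y and x = y. The substitution a x + b y = a (x - y) + (a + b) y
   turns the first two parts into sums over a < b and a > b. Applied to
   symmetric functions of u, v, -(u + v) of degree 2, 4 and 6 this evaluates
   the convolutions of sigma_1 with sigma_1, sigma_3, sigma_5 and of sigma_3
   with itself. In terms of the Eisenstein series P, Q, R (of weights 2, 4, 6)
   and ' = q d/dq these are Ramanujan's identities, which amount to
   Q = P^2 - 12 P', R = P Q - 3 Q' and the Chazy equation
   2 P P'' - 3 P'^2 - 2 P''' = 0.
   Hence Q^3 - R^2 satisfies y' = P y, as does q prod (1 - q^k)^24, so the two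
   are proportional. Modulo the Chazy equation, the right-hand sides of the
   theorem are (Q^3 - R^2) / 1728. All power series are polynomials modulo
   'X^N. *)

(** * Sums over the representations n = a x + b y *)

Lemma eq_big_bij (V : nmodType) (I J : eqType) (r : seq I) (s : seq J)
    (f : I -> J) (g : J -> I) (F : J -> V) :
    uniq r -> uniq s ->
    {in r, forall i, f i \in s /\ g (f i) = i} ->
    {in s, forall j, g j \in r /\ f (g j) = j} ->
  \sum_(j <- s) F j = \sum_(i <- r) F (f i).
Proof.
move=> Ur Us fP gP; rewrite -(big_map f xpredT F); apply: perm_big.
apply: uniq_perm => // [|j].
  rewrite map_inj_in_uniq // => i j ri rj eq_f.
  by have [_ <-] := fP i ri; have [_ <-] := fP j rj; rewrite eq_f.
apply/idP/mapP => [sj|[i ri ->]]; last by have [] := fP i ri.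
by have [rgj fgj] := gP j sj; exists (g j).
Qed.

(* [((a, x), (b, y))] stands for the representation [n = a x + b y]. *)
Definition reps (n : nat) : seq ((nat * nat) * (nat * nat)) :=
  let r := index_iota 1 n in let rr := [seq (i, j) | i <- r, j <- r] in
  [seq t <- [seq (u, v) | u <- rr, v <- rr]
         | (t.1.1 * t.1.2 + t.2.1 * t.2.2 == n)%N].

Lemma uniq_reps n : uniq (reps n).
Proof.
have Urr : uniq [seq (i, j) | i <- index_iota 1 n, j <- index_iota 1 n].
  by apply: allpairs_uniq; rewrite ?iota_uniq // => -[? ?] [? ?].
by apply/filter_uniq/allpairs_uniq => // -[? ?] [? ?].
Qed.

Lemma mem_reps n a x b y :
  (((a, x), (b, y)) \in reps n) =
  [&& 0 < a, 0 < x, 0 < b, 0 < y & a * x + b * y == n]%N.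
Proof.
rewrite mem_filter /=; apply/idP/idP => [/andP[-> ]|].
  case/allpairsP=> -[u v] [/= /allpairsP[[i j] [/= ri rj ->]]].
  case/allpairsP=> -[k l] [/= rk rl ->] [-> -> -> ->].
  by move: ri rj rk rl; rewrite !mem_index_iota; lia.
(* Both products are positive with sum [n], so all four entries are below [n] and the range
   [index_iota 1 n] loses no representation. *)
case/and5P=> a0 x0 b0 y0 eqn; rewrite eqn /=.
by do 2?[apply: allpairs_f]; rewrite mem_index_iota; nia.
Qed.

Lemma uniq_filter_reps n P : uniq [seq t <- reps n | P t].
Proof. exact/filter_uniq/uniq_reps. Qed.

Lemma mem_filter_reps n P a x b y :
  (((a, x), (b, y)) \in [seq t <- reps n | P t]) =
  P ((a, x), (b, y)) && [&& 0 < a, 0 < x, 0 < b, 0 < y & a * x + b * y == n]%N.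
Proof. by rewrite mem_filter mem_reps. Qed.

Section Descent.

Variables (V : zmodType) (n : nat).
Implicit Type H : nat -> nat -> V.

Let rsum (P : pred ((nat * nat) * (nat * nat))) H :=
  \sum_(t <- reps n | P t) H t.1.1 t.2.1.

Lemma sum_reps_swap P H :
  rsum P H = rsum (fun t => P (t.2, t.1)) (fun a b => H b a).
Proof.
rewrite /rsum -big_filter -[RHS]big_filter.
apply: (eq_big_bij (f := fun t => (t.2, t.1)) (g := fun t => (t.2, t.1)));
  rewrite ?uniq_filter_reps // => -[[a x] [b y]];
  by rewrite !mem_filter_reps /= => /andP[-> /=]; split=> //; lia.
Qed.

(* The bijection [a x + b y = a (x - y) + (a + b) y]. *)
Lemma sum_reps_gt H :
  rsum (fun t => t.2.2 < t.1.2)%N H =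
  rsum (fun t => t.1.1 < t.2.1)%N (fun a b => H a (b - a)%N).
Proof.
rewrite /rsum -big_filter -[RHS]big_filter.
apply: (eq_big_bij
  (f := fun t => ((t.1.1, t.1.2 + t.2.2), (t.2.1 - t.1.1, t.2.2)))
  (g := fun t => ((t.1.1, t.1.2 - t.2.2), (t.1.1 + t.2.1, t.2.2))))%N;
  rewrite ?uniq_filter_reps // => -[[a x] [b y]];
  rewrite !mem_filter_reps /= => /andP[lt /and5P[a0 x0 b0 y0 /eqP eqn]].
- by split; [nia | do 2?congr (_, _); lia].
- by split; [nia | do 2?congr (_, _); lia].
Qed.

Lemma sum_reps_descent H :
  \sum_(t <- reps n) H t.1.1 t.2.1 =
  \sum_(t <- reps n | t.1.1 != t.2.1)
     (if (t.1.1 < t.2.1)%N then H t.1.1 (t.2.1 - t.1.1)%N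
      else H (t.1.1 - t.2.1)%N t.2.1)
  + \sum_(t <- reps n | t.1.2 == t.2.2) H t.1.1 t.2.1.
Proof.
rewrite (bigID (fun t => t.1.2 == t.2.2)) /= addrC; congr (_ + _).
rewrite (bigID (fun t => t.2.2 < t.1.2)%N) /=.
rewrite [RHS](bigID (fun t => t.1.1 < t.2.1)%N) /=; congr (_ + _).
  have := sum_reps_gt H; rewrite /rsum => eqH.
  transitivity (rsum (fun t => t.2.2 < t.1.2)%N H).
    by apply: eq_bigl => t; lia.
  by rewrite /rsum eqH; apply: eq_big => [t|t ->] //; lia.
transitivity (rsum (fun t => t.1.2 < t.2.2)%N H).
  by apply: eq_bigl => t; lia.
(* For [x < y]: exchange the two pairs, apply the bijection, exchange back. *)
rewrite sum_reps_swap /= sum_reps_gt sum_reps_swap /=.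
apply: eq_big => [t|t lt]; first by lia.
by rewrite ifN //; lia.
Qed.

End Descent.

Lemma uniq_dep_pairs (I J : eqType) (s : seq I) (t : I -> seq J) :
  uniq s -> (forall i, uniq (t i)) -> uniq [seq (i, j) | i <- s, j <- t i].
Proof.
by move=> Us Ut; apply: allpairs_uniq_dep => // -[i j] [k l] _ _ [-> ->].
Qed.

Lemma mem_dep_pairs (I J : eqType) (s : seq I) (t : I -> seq J) i j :
  ((i, j) \in [seq (k, l) | k <- s, l <- t k]) = (i \in s) && (j \in t i).
Proof.
apply/allpairsPdep/andP => [[k [l [sk tl [-> ->]]]]|[si tj]] //.
by exists i, j.
Qed.

(** Put [m = a x]: a representation amounts to [m] together with a divisor [a] of [m] and a divisor
    [b] of [n - m]. *)
Lemma sum_reps_conv (R : pzSemiRingType) n (F G : nat -> R) :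
  \sum_(t <- reps n) F t.1.1 * G t.2.1 =
  \sum_(1 <= m < n) (\sum_(a <- divisors m) F a)
                    * (\sum_(b <- divisors (n - m)) G b).
Proof.
pose U := [seq (m, p) | m <- index_iota 1 n,
             p <- [seq (a, b) | a <- divisors m, b <- divisors (n - m)]].
transitivity (\sum_(u <- U) F u.2.1 * G u.2.2); last first.
  rewrite big_allpairs_dep; apply: eq_bigr => m _.
  rewrite big_allpairs_dep big_distrl; apply: eq_bigr => a _.
  by rewrite big_distrr.
apply: (eq_big_bij
  (f := fun u => ((u.2.1, u.1 %/ u.2.1), (u.2.2, (n - u.1) %/ u.2.2)))
  (g := fun t => (t.1.1 * t.1.2, (t.1.1, t.2.1))))%N.
- apply: uniq_dep_pairs => [|m]; first exact: iota_uniq.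
  by apply: uniq_dep_pairs => *; apply: divisors_uniq.
- exact: uniq_reps.
- move=> [m [a b]] /=; rewrite !mem_dep_pairs mem_reps mem_index_iota.
  case/and3P=> /andP[m0 mn]; rewrite -!dvdn_divisors ?subn_gt0 // => am bm.
  have [a0 b0] : (0 < a)%N /\ (0 < b)%N.
    by split; apply: dvdn_gt0 (am) || apply: dvdn_gt0 (bm); rewrite ?subn_gt0.
  have nm0 : (0 < n - m)%N by rewrite subn_gt0.
  rewrite a0 b0 !divn_gt0 // (dvdn_leq m0 am) (dvdn_leq nm0 bm) /=.
  by rewrite [(a * _)%N]mulnC [(b * _)%N]mulnC !divnK // subnKC 1?ltnW.
- move=> [[a x] [b y]]; rewrite mem_reps => /and5P[a0 x0 b0 y0 /eqP eqn] /=.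
  rewrite !mem_dep_pairs mem_index_iota -eqn addKn !mulKn //.
  rewrite -!dvdn_divisors ?muln_gt0 ?a0 ?b0 // !dvdn_mulr //.
  by split=> //; nia.
Qed.

(** For [a = b = d] the equation reads [n = d (x + y)], so [d] divides [n] and [x] takes
    [n %/ d - 1] values. *)
Lemma sum_reps_diag (V : nmodType) n (F : nat -> V) : (0 < n)%N ->
  \sum_(t <- reps n | t.1.1 == t.2.1) F t.1.1 =
  \sum_(d <- divisors n) F d *+ (n %/ d - 1).
Proof.
move=> n0; pose U := [seq (d, x) | d <- divisors n, x <- index_iota 1 (n %/ d)].
transitivity (\sum_(u <- U) F u.1); last first.
  rewrite big_allpairs_dep; apply: eq_bigr => d _.
  by rewrite /= big_const_seq count_predT size_iota iter_addr_0.
rewrite -big_filter; apply: (eq_big_bij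
  (f := fun u => ((u.1, u.2), (u.1, n %/ u.1 - u.2)))
  (g := fun t => (t.1.1, t.1.2)))%N.
- by apply: uniq_dep_pairs => *; rewrite ?divisors_uniq ?iota_uniq.
- exact: uniq_filter_reps.
- move=> [d x] /=; rewrite mem_dep_pairs mem_filter_reps mem_index_iota /=.
  rewrite -dvdn_divisors // => /and3P[dn x0 xd]; have d0 := dvdn_gt0 n0 dn.
  rewrite eqxx d0 x0 subn_gt0 xd -mulnDr subnKC 1?ltnW //.
  by rewrite mulnC divnK //= eqxx.
- move=> [[a x] [b y]]; rewrite mem_filter_reps /=.
  move=> /and3P[/eqP <- a0 /and4P[x0 _ y0 /eqP eqn]].
  rewrite mem_dep_pairs mem_index_iota -dvdn_divisors // -eqn -mulnDr mulKn //.
  by rewrite dvdn_mulr //; split; [lia | do 2?congr (_, _); lia].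
Qed.

(** Dually, for [x = y] the equation reads [n = (a + b) x], and [d = a + b] runs over the divisors
    of [n]. *)
Lemma sum_reps_codiag (V : nmodType) n (H : nat -> nat -> V) : (0 < n)%N ->
  \sum_(t <- reps n | t.1.2 == t.2.2) H t.1.1 t.2.1 =
  \sum_(d <- divisors n) \sum_(1 <= a < d) H a (d - a)%N.
Proof.
move=> n0; pose U := [seq (d, a) | d <- divisors n, a <- index_iota 1 d].
transitivity (\sum_(u <- U) H u.2 (u.1 - u.2)%N); last first.
  by rewrite big_allpairs_dep.
rewrite -big_filter; apply: (eq_big_bij
  (f := fun u => ((u.2, n %/ u.1), (u.1 - u.2, n %/ u.1)))
  (g := fun t => (t.1.1 + t.2.1, t.1.1)))%N.
- by apply: uniq_dep_pairs => *; rewrite ?divisors_uniq ?iota_uniq.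
- exact: uniq_filter_reps.
- move=> [d a] /=; rewrite mem_dep_pairs mem_filter_reps mem_index_iota /=.
  rewrite -dvdn_divisors // => /and3P[dn a0 ad]; have d0 := dvdn_gt0 n0 dn.
  rewrite eqxx divn_gt0 // (dvdn_leq n0 dn) a0 subn_gt0 ad.
  rewrite -mulnDl subnKC 1?ltnW //.
  by rewrite mulnC divnK //= eqxx.
- move=> [[a x] [b y]]; rewrite mem_filter_reps /=.
  move=> /and3P[/eqP <- a0 /and4P[x0 b0 _ /eqP eqn]].
  rewrite mem_dep_pairs mem_index_iota -dvdn_divisors // -eqn -mulnDl.
  rewrite mulKn ?addn_gt0 ?a0 //.
  by rewrite dvdn_mulr //; split; [lia | do 2?congr (_, _); lia].
Qed.

(** Faulhaber's formulas up to degree 6, the largest degree of the functions [H] below. *)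
Lemma sum_poly6 (c0 c1 c2 c3 c4 c5 c6 : rat) (d : nat) : (0 < d)%N ->
  let x : rat := d%:R in
  \sum_(1 <= a < d) (c0 + c1 * a%:R + c2 * a%:R ^+ 2 + c3 * a%:R ^+ 3
                     + c4 * a%:R ^+ 4 + c5 * a%:R ^+ 5 + c6 * a%:R ^+ 6) =
  c0 * (x - 1) + c1 * (x ^+ 2 - x) / 2
  + c2 * (2 * x ^+ 3 - 3 * x ^+ 2 + x) / 6
  + c3 * (x ^+ 4 - 2 * x ^+ 3 + x ^+ 2) / 4
  + c4 * (6 * x ^+ 5 - 15 * x ^+ 4 + 10 * x ^+ 3 - x) / 30
  + c5 * (2 * x ^+ 6 - 6 * x ^+ 5 + 5 * x ^+ 4 - x ^+ 2) / 12
  + c6 * (6 * x ^+ 7 - 21 * x ^+ 6 + 21 * x ^+ 5 - 7 * x ^+ 3 + x) / 42.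
Proof.
case: d => // d _; elim: d => [|d IHd] /=; first by rewrite big_geq //; field.
by rewrite big_nat_recr //= IHd -[d.+2%:R]natr1; field.
Qed.

(** * Convolutions of divisor sums *)

Definition ratsigma (k n : nat) : rat := (sigma k n)%:R.

Lemma ratsigmaE k n : ratsigma k n = \sum_(d <- divisors n) d%:R ^+ k.
Proof. by rewrite /ratsigma natr_sum; apply: eq_bigr => d _; rewrite natrX. Qed.

Definition conv (k l n : nat) : rat :=
  \sum_(1 <= m < n) ratsigma k m * ratsigma l (n - m).

Lemma sum_reps_pow k l n :
  \sum_(t <- reps n) t.1.1%:R ^+ k * t.2.1%:R ^+ l = conv k l n.
Proof.
rewrite (sum_reps_conv n (fun a => a%:R ^+ k) (fun b => b%:R ^+ l)).
by apply: eq_bigr => m _; rewrite !ratsigmaE.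
Qed.

Lemma convC k l n : conv k l n = conv l k n.
Proof.
rewrite /conv big_nat_rev; apply: eq_big_nat => m /andP[m0 mn] /=.
by rewrite mulrC; congr (ratsigma _ _ * ratsigma _ _); lia.
Qed.

Lemma sum_divisors_pred n k : (0 < n)%N ->
  \sum_(d <- divisors n) d%:R ^+ k.+1 *+ (n %/ d - 1) =
  n%:R * ratsigma k n - ratsigma k.+1 n.
Proof.
move=> n0; rewrite !ratsigmaE mulr_sumr -sumrB; apply: eq_big_seq => d.
rewrite -dvdn_divisors // => dn; have d0 := dvdn_gt0 n0 dn.
have -> : n%:R = (n %/ d)%:R * d%:R :> rat by rewrite -natrM divnK.
rewrite mulrnBr ?divn_gt0 ?(dvdn_leq n0 dn) // mulr1n exprS.
by rewrite -[X in X - _]mulr_natl mulrA.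
Qed.

(** The hypotheses hold for symmetric functions of even degree in [u], [v], [-(u + v)]: up to order,
    the triples [u - v, v, -u] and [v - u, u, -v] are opposite. They turn both branches of the
    descent into [H (a - b) b], which cancels the subtracted sum where [a] and [b] differ. Only the
    diagonals [a = b] and [x = y] survive. *)
Lemma reps_symmetric_identity n (H : rat -> rat -> rat) : (0 < n)%N ->
    (forall u v, H (u - v) v = H (v - u) u) ->
    (forall u v, H u v = H v u) ->
  \sum_(t <- reps n) (H t.1.1%:R t.2.1%:R - H (t.1.1%:R - t.2.1%:R) t.2.1%:R)
  + \sum_(d <- divisors n) H 0 d%:R *+ (n %/ d - 1) =
  \sum_(d <- divisors n) \sum_(1 <= a < d) H a%:R (d%:R - a%:R).
Proof.
move=> n0 Hdiff Hsym; rewrite sumrB.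
rewrite (sum_reps_descent n (fun a b => H a%:R b%:R)).
rewrite (sum_reps_codiag (fun a b => H a%:R b%:R)) //.
rewrite -(sum_reps_diag (fun d => H 0 d%:R)) //.
rewrite [X in _ - X + _](bigID (fun t => t.1.1 != t.2.1)) /=.
have -> : \sum_(t <- reps n | ~~ (t.1.1 != t.2.1))
    H (t.1.1%:R - t.2.1%:R) t.2.1%:R =
    \sum_(t <- reps n | t.1.1 == t.2.1) H 0 t.1.1%:R.
  by apply: eq_big => [t|t /negbNE/eqP->]; [exact: negbK | rewrite subrr].
rewrite [X in X + _ - _ + _](eq_bigr
  (fun t => H (t.1.1%:R - t.2.1%:R) t.2.1%:R)); last first.
  move=> t _; case: ltnP => [lt|le]; rewrite natrB //; last exact: ltnW.
  by rewrite Hsym Hdiff.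
set u := \sum_(_ <- _ | _ != _) _; set v := \sum_(_ <- _ | _) _.
rewrite [u + _]addrC opprD addrA addrK subrK.
apply: eq_bigr => d _; apply: eq_big_nat => a /andP[_ /ltnW ad].
by rewrite natrB.
Qed.

Lemma eq_sum_divisors n (F G : nat -> rat) : (0 < n)%N ->
    (forall d, (0 < d)%N -> F d = G d) ->
  \sum_(d <- divisors n) F d = \sum_(d <- divisors n) G d.
Proof.
move=> n0 eqFG; apply: eq_big_seq => d; rewrite -dvdn_divisors //.
by move/(dvdn_gt0 n0)/eqFG.
Qed.

Lemma sum_divisors_poly7 (c1 c2 c3 c4 c5 c6 c7 : rat) n :
  \sum_(d <- divisors n) (c1 * d%:R + c2 * d%:R ^+ 2 + c3 * d%:R ^+ 3
     + c4 * d%:R ^+ 4 + c5 * d%:R ^+ 5 + c6 * d%:R ^+ 6 + c7 * d%:R ^+ 7) =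
  c1 * ratsigma 1 n + c2 * ratsigma 2 n + c3 * ratsigma 3 n
  + c4 * ratsigma 4 n + c5 * ratsigma 5 n + c6 * ratsigma 6 n
  + c7 * ratsigma 7 n.
Proof. by rewrite !ratsigmaE !mulr_sumr -!big_split. Qed.

(** Up to sign [H] is the second elementary symmetric function of [u], [v], [-(u + v)], and
    [H u v - H (u - v) v = 2 u v]. *)
Lemma conv11 n : (0 < n)%N ->
  12 * conv 1 1 n =
  5 * ratsigma 3 n + (1 - 6 * n%:R) * ratsigma 1 n.
Proof.
move=> n0; pose H (u v : rat) := u ^+ 2 + u * v + v ^+ 2.
have Hdiff u v : H (u - v) v = H (v - u) u by rewrite /H; ring.
have Hsym u v : H u v = H v u by rewrite /H; ring.
have := reps_symmetric_identity n0 Hdiff Hsym.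
rewrite (_ : \sum_(t <- _) _ = 2 * conv 1 1 n); last first.
  by rewrite -sum_reps_pow mulr_sumr; apply: eq_bigr => t _; rewrite /H; ring.
rewrite (eq_bigr (fun d => d%:R ^+ 2 *+ (n %/ d - 1))) => [|d _]; last first.
  by congr (_ *+ _); rewrite /H; ring.
rewrite sum_divisors_pred //.
(* [G] is the sum of [H a (d - a)] over [0 < a < d], as given by [sum_poly6]. The next three proofs
   follow the same pattern. *)
rewrite (eq_sum_divisors (G := fun d => 6^-1 * d%:R + (- 1) * d%:R ^+ 2
    + 5 / 6 * d%:R ^+ 3 + 0 * d%:R ^+ 4 + 0 * d%:R ^+ 5
    + 0 * d%:R ^+ 6 + 0 * d%:R ^+ 7) n0) => [|d d0].
  by rewrite sum_divisors_poly7; lra.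
set x : rat := d%:R.
rewrite (eq_bigr (fun a : nat => x ^+ 2 + (- x) * a%:R
    + 1 * a%:R ^+ 2 + 0 * a%:R ^+ 3 + 0 * a%:R ^+ 4
    + 0 * a%:R ^+ 5 + 0 * a%:R ^+ 6)).
  by rewrite sum_poly6 // -/x /=; field.
by move=> a _; rewrite /H; ring.
Qed.

(** For the square of the previous form the difference is [4 u^3 v + 4 u v^3]. *)
Lemma conv13 n : (0 < n)%N ->
  240 * conv 1 3 n =
  21 * ratsigma 5 n + (10 - 30 * n%:R) * ratsigma 3 n - ratsigma 1 n.
Proof.
move=> n0; pose H (u v : rat) := (u ^+ 2 + u * v + v ^+ 2) ^+ 2.
have Hdiff u v : H (u - v) v = H (v - u) u by rewrite /H; ring.
have Hsym u v : H u v = H v u by rewrite /H; ring.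
have := reps_symmetric_identity n0 Hdiff Hsym.
rewrite (_ : \sum_(t <- _) _ = 4 * conv 1 3 n + 4 * conv 3 1 n); last first.
  rewrite -!sum_reps_pow !mulr_sumr -big_split /=.
  by apply: eq_bigr => t _; rewrite /H; ring.
rewrite (eq_bigr (fun d => d%:R ^+ 4 *+ (n %/ d - 1))) => [|d _]; last first.
  by congr (_ *+ _); rewrite /H; ring.
rewrite sum_divisors_pred //.
rewrite (eq_sum_divisors (G := fun d => (- 30^-1) * d%:R + 0 * d%:R ^+ 2
    + 3^-1 * d%:R ^+ 3 + (- 1) * d%:R ^+ 4 + 7 / 10 * d%:R ^+ 5
    + 0 * d%:R ^+ 6 + 0 * d%:R ^+ 7) n0) => [|d d0].
  by rewrite sum_divisors_poly7; rewrite (convC 3 1); lra.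
set x : rat := d%:R.
rewrite (eq_bigr (fun a : nat => x ^+ 4 + (- 2 * x ^+ 3) * a%:R
    + 3 * x ^+ 2 * a%:R ^+ 2 + (- 2 * x) * a%:R ^+ 3 + 1 * a%:R ^+ 4
    + 0 * a%:R ^+ 5 + 0 * a%:R ^+ 6)).
  by rewrite sum_poly6 // -/x /=; field.
by move=> a _; rewrite /H; ring.
Qed.

(** Now [H] is the square of the third elementary symmetric function. The difference is [4 u^3 v^3],
    and [H 0 v = 0] removes the diagonal term. *)
Lemma conv33 n : (0 < n)%N ->
  120 * conv 3 3 n = ratsigma 7 n - ratsigma 3 n.
Proof.
move=> n0; pose H (u v : rat) := (u * v * (u + v)) ^+ 2.
have Hdiff u v : H (u - v) v = H (v - u) u by rewrite /H; ring.
have Hsym u v : H u v = H v u by rewrite /H; ring.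
have := reps_symmetric_identity n0 Hdiff Hsym.
rewrite (_ : \sum_(t <- _) _ = 4 * conv 3 3 n); last first.
  by rewrite -sum_reps_pow mulr_sumr; apply: eq_bigr => t _; rewrite /H; ring.
rewrite [X in _ + X]big1 => [|d _]; last by rewrite /H !mul0r expr0n mul0rn.
rewrite addr0.
rewrite (eq_sum_divisors (G := fun d => 0 * d%:R + 0 * d%:R ^+ 2
    + (- 30^-1) * d%:R ^+ 3 + 0 * d%:R ^+ 4 + 0 * d%:R ^+ 5
    + 0 * d%:R ^+ 6 + 30^-1 * d%:R ^+ 7) n0) => [|d d0].
  by rewrite sum_divisors_poly7; lra.
set x : rat := d%:R.
rewrite (eq_bigr (fun a : nat => 0 + 0 * a%:R
    + x ^+ 4 * a%:R ^+ 2 + (- 2 * x ^+ 3) * a%:R ^+ 3 + x ^+ 2 * a%:R ^+ 4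
    + 0 * a%:R ^+ 5 + 0 * a%:R ^+ 6)).
  by rewrite sum_poly6 // -/x /=; field.
by move=> a _; rewrite /H; ring.
Qed.

(** The difference is [6 u^5 v + 14 u^3 v^3 + 6 u v^5], whose middle term is eliminated by
    [conv33]. *)
Lemma conv15 n : (0 < n)%N ->
  504 * conv 1 5 n =
  20 * ratsigma 7 n + (21 - 42 * n%:R) * ratsigma 5 n + ratsigma 1 n.
Proof.
move=> n0; pose H (u v : rat) := (u ^+ 2 + u * v + v ^+ 2) ^+ 3.
have Hdiff u v : H (u - v) v = H (v - u) u by rewrite /H; ring.
have Hsym u v : H u v = H v u by rewrite /H; ring.
have := reps_symmetric_identity n0 Hdiff Hsym.
rewrite (_ : \sum_(t <- _) _ =
    6 * conv 1 5 n + 14 * conv 3 3 n + 6 * conv 5 1 n); last first.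
  rewrite -!sum_reps_pow !mulr_sumr -!big_split /=.
  by apply: eq_bigr => t _; rewrite /H; ring.
rewrite (eq_bigr (fun d => d%:R ^+ 6 *+ (n %/ d - 1))) => [|d _]; last first.
  by congr (_ *+ _); rewrite /H; ring.
rewrite sum_divisors_pred //.
rewrite (eq_sum_divisors (G := fun d => 42^-1 * d%:R + 0 * d%:R ^+ 2
    + (- (7 / 60)) * d%:R ^+ 3 + 0 * d%:R ^+ 4 + 2^-1 * d%:R ^+ 5
    + (- 1) * d%:R ^+ 6 + 83 / 140 * d%:R ^+ 7) n0) => [|d d0].
  by rewrite sum_divisors_poly7; have := conv33 n0; rewrite (convC 5 1); lra.
set x : rat := d%:R.
rewrite (eq_bigr (fun a : nat => x ^+ 6 + (- 3 * x ^+ 5) * a%:R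
    + 6 * x ^+ 4 * a%:R ^+ 2 + (- 7 * x ^+ 3) * a%:R ^+ 3
    + 6 * x ^+ 2 * a%:R ^+ 4
    + (- 3 * x) * a%:R ^+ 5 + 1 * a%:R ^+ 6)).
  by rewrite sum_poly6 // -/x /=; field.
by move=> a _; rewrite /H; ring.
Qed.


(** * Power series modulo 'X^N *)

(* Locked, so that [theta (theta p)] is not seen as the [theta] of a product. *)
HB.lock Definition theta (R : comNzRingType) (p : {poly R}) : {poly R} :=
  'X * p^`().

Section TruncatedSeries.

Variable R : comNzRingType.
Implicit Types p q f g : {poly R}.

Lemma coef_theta p i : (theta p)`_i = i%:R * p`_i.
Proof.
rewrite unlock coefXM coef_deriv.
by case: i => [|i]; rewrite ?mul0r ?mulr_natl.
Qed.

Lemma thetaD p q : theta (p + q) = theta p + theta q.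
Proof. by rewrite unlock derivD mulrDr. Qed.

Lemma thetaN p : theta (- p) = - theta p.
Proof. by rewrite unlock derivN mulrN. Qed.

Lemma thetaM p q : theta (p * q) = theta p * q + p * theta q.
Proof. by rewrite unlock derivM; ring. Qed.

Lemma thetaXn p n : theta (p ^+ n.+1) = n.+1%:R * p ^+ n * theta p.
Proof. by rewrite unlock deriv_exp -mulr_natl /=; ring. Qed.

Lemma theta_nat n : theta (n%:R : {poly R}) = 0.
Proof. by rewrite unlock -polyC_natr derivC mulr0. Qed.

Lemma theta1 : theta (1 : {poly R}) = 0. Proof. exact: (theta_nat 1). Qed.

Lemma theta0 : theta (0 : {poly R}) = 0. Proof. exact: (theta_nat 0). Qed.

Lemma theta_natM n p : theta (n%:R * p) = n%:R * theta p.
Proof. by rewrite thetaM theta_nat mul0r add0r. Qed.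

(** [theta_natM] precedes [thetaM], so that numeral factors come out without leaving [theta] of a
    numeral. *)
Definition thetaE :=
  (theta0, theta1, theta_natM, thetaN, thetaXn, thetaM, thetaD).

Lemma coef_natM n p i : (n%:R * p)`_i = n%:R * p`_i.
Proof. by rewrite mulr_natl coefMn mulr_natl. Qed.

Definition vanish (N : nat) p := forall i, (i < N)%N -> p`_i = 0.

Variable N : nat.

Lemma vanishD p q : vanish N p -> vanish N q -> vanish N (p + q).
Proof. by move=> vp vq i iN; rewrite coefD vp ?vq ?addr0. Qed.

Lemma vanishM q p : vanish N p -> vanish N (q * p).
Proof.
move=> vp i iN; rewrite coefM big1 // => j _.
by rewrite vp ?mulr0 // (leq_ltn_trans (leq_subr _ _)).
Qed.

Lemma vanishN p : vanish N p -> vanish N (- p).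
Proof. by move=> vp; rewrite -mulN1r; apply: vanishM. Qed.

Lemma vanishB p q : vanish N p -> vanish N q -> vanish N (p - q).
Proof. by move=> vp vq; apply/vanishD/vanishN. Qed.

Lemma vanish_theta p : vanish N p -> vanish N (theta p).
Proof. by move=> vp i iN; rewrite coef_theta vp ?mulr0. Qed.

(* [g] is the logarithmic derivative of [f] up to order [N]. *)
Definition logderiv g f := vanish N (theta f - g * f).

Lemma logderivM g1 f1 g2 f2 :
  logderiv g1 f1 -> logderiv g2 f2 -> logderiv (g1 + g2) (f1 * f2).
Proof.
move=> /(vanishM f2) h1 /(vanishM f1) h2; have := vanishD h1 h2.
by rewrite /logderiv thetaM; congr vanish; ring.
Qed.

Lemma logderivX g f n : logderiv g f -> logderiv (n%:R * g) (f ^+ n).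
Proof.
move=> gf; elim: n => [|n IHn].
  by rewrite /logderiv expr0 theta1 !mul0r subr0 => i _; rewrite coef0.
have := logderivM gf IHn.
by rewrite -exprS -{1}[g]mul1r -mulrDl addrC natr1.
Qed.

Lemma logderiv_prod (I : Type) (r : seq I) (g f : I -> {poly R}) (P : pred I) :
    (forall i, P i -> logderiv (g i) (f i)) ->
  logderiv (\sum_(i <- r | P i) g i) (\prod_(i <- r | P i) f i).
Proof.
move=> gf; apply: (big_ind2 logderiv) => //.
  by rewrite /logderiv theta1 mul0r subr0 => i _; rewrite coef0.
by move=> *; apply: logderivM.
Qed.

(** The truncation of [k q^k / (1 - q^k)], which is minus the logarithmic derivative of
    [1 - q^k]. *)
Definition lambert (k : nat) : {poly R} :=
  \poly_(i < N) if (0 < i)%N && (k %| i)%N then k%:R else 0.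

Lemma logderiv_1BXn k : (0 < k)%N -> logderiv (- lambert k) (1 - 'X^k).
Proof.
move=> k0 i iN.
rewrite thetaD theta1 thetaN unlock derivXn add0r mulNr opprK mulrBr mulr1.
rewrite coefD coefB coefN coefMXn coefXM coefMn coefXn !coef_poly iN.
case: i iN => [|i] iN /=; first by rewrite k0 /= !(oppr0, addr0).
have -> : (i == k.-1) = (i.+1 == k) by lia.
(* Beyond degree [k], the Lambert coefficients at [i.+1] and [i.+1 - k] cancel; at degree [k] the
   latter is the zero constant term, and [theta] supplies the [k]. *)
case: (ltngtP i.+1 k) => [lt|lt|eq_k]; last 1 first.
- by rewrite eq_k subnn dvdnn if_same subr0 addNr.
- by rewrite gtnNdvd // mul0rn !(oppr0, addr0).
rewrite subn_gt0 lt mul0rn oppr0 add0r (leq_ltn_trans (leq_subr _ _) iN).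
by rewrite dvdn_subl ?subrr // ltnW.
Qed.

End TruncatedSeries.

Lemma lambert_sum N i : (0 < i < N)%N ->
  (\sum_(1 <= k < N) lambert rat N k)`_i = ratsigma 1 i.
Proof.
move=> /andP[i0 iN]; rewrite ratsigmaE coef_sum.
under eq_bigr do rewrite coef_poly iN i0 /=.
rewrite -big_mkcond -big_filter; apply: perm_big.
apply: uniq_perm; rewrite ?filter_uniq ?iota_uniq ?divisors_uniq // => k.
rewrite mem_filter mem_index_iota -dvdn_divisors // andbC.
apply: andb_idl => ki; rewrite (dvdn_gt0 i0 ki).
exact: leq_ltn_trans (dvdn_leq i0 ki) iN.
Qed.

(** In degree [i] the equation reads [(i - 1) A_i = P_1 A_(i-1) + ... + P_i A_0], so all
    coefficients from degree 2 on are determined by the first two. *)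
Lemma vanish_ode (P A : {poly rat}) N :
  P`_0 = 1 -> A`_0 = 0 -> A`_1 = 0 -> logderiv N P A -> vanish N A.
Proof.
move=> P0 A0 A1 ode i; elim/ltn_ind: i => -[|[|i]] // IHi iN.
have := ode _ iN; rewrite coefB coef_theta coefM big_ord_recl subn0 P0 mul1r.
rewrite big1 => [|j _]; last first.
  by rewrite IHi ?mulr0 //= /bump; lia.
rewrite addr0 -{2}[A`_ _]mul1r -mulrBl => /eqP.
rewrite mulf_eq0 => /orP[|/eqP//].
by rewrite subr_eq0 pnatr_eq1.
Qed.

(** * Generating series of the divisor sums *)

Definition sigma_series (k N : nat) : {poly rat} :=
  \poly_(i < N) if (0 < i)%N then ratsigma k i else 0.

Lemma coef_sigma_series k N i : (0 < i < N)%N ->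
  (sigma_series k N)`_i = ratsigma k i.
Proof. by case/andP=> i0 iN; rewrite coef_poly iN i0. Qed.

Lemma coef0_sigma_series k N : (sigma_series k N)`_0 = 0.
Proof. by rewrite coef_poly if_same. Qed.

Lemma coef_iter_theta (p : {poly rat}) k i :
  (iter k (@theta rat) p)`_i = i%:R ^+ k * p`_i.
Proof.
by elim: k => [|k IHk] /=; rewrite ?mul1r // coef_theta IHk exprS mulrA.
Qed.

(** The end terms of the Cauchy product vanish because the series have no constant term. *)
Lemma coef_sigma_seriesM j k l N i : (i < N)%N ->
  (iter j (@theta rat) (sigma_series k N) * sigma_series l N)`_i =
  \sum_(1 <= m < i) m%:R ^+ j * (ratsigma k m * ratsigma l (i - m)).
Proof.
case: i => [|i] iN.
  by rewrite coef0M !coef0_sigma_series mulr0 big_geq.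
rewrite coefM -(big_mkord xpredT (fun m =>
  (iter j (@theta rat) (sigma_series k N))`_m
  * (sigma_series l N)`_(i.+1 - m))).
rewrite big_nat_recr //= subnn coef0_sigma_series mulr0 addr0.
rewrite big_ltn // coef_iter_theta coef0_sigma_series mulr0 mul0r add0r.
apply: eq_big_nat => m /andP[m0 mi].
rewrite coef_iter_theta !coef_sigma_series ?mulrA //; last first.
  by rewrite m0 (ltn_trans mi).
by rewrite subn_gt0 mi (leq_ltn_trans (leq_subr _ _)).
Qed.

Lemma coef_convolution k l N i : (i < N)%N ->
  (sigma_series k N * sigma_series l N)`_i = conv k l i.
Proof.
move=> iN; rewrite (coef_sigma_seriesM 0) //.
by apply: eq_bigr => m _; rewrite mul1r.
Qed.

(** * Ramanujan's identities as congruences *)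

Section Ramanujan.

Variable N : nat.
Notation s := (sigma_series ^~ N).

(** The factor [n] in [conv11] becomes [theta]; in degree 0, which [conv11] excludes, every term is
    zero. *)
Lemma vanish_conv11 :
  vanish N (12 * (s 1%N * s 1%N) - 5 * s 3 - s 1%N + 6 * theta (s 1%N)).
Proof.
move=> i iN; rewrite !(coefD, coefN, coef_natM, coef_theta) coef_convolution //.
case: i iN => [|i] iN.
  by rewrite !coef0_sigma_series /conv big_geq //; ring.
by rewrite !coef_sigma_series // conv11 //; ring.
Qed.

Lemma vanish_conv13 :
  vanish N (240 * (s 1%N * s 3) - 21 * s 5 - 10 * s 3
            + 30 * theta (s 3) + s 1%N).
Proof.
move=> i iN; rewrite !(coefD, coefN, coef_natM, coef_theta) coef_convolution //.
case: i iN => [|i] iN.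
  by rewrite !coef0_sigma_series /conv big_geq //; ring.
by rewrite !coef_sigma_series // conv13 //; ring.
Qed.

Lemma vanish_conv15 :
  vanish N (504 * (s 1%N * s 5) - 20 * s 7 - 21 * s 5
            + 42 * theta (s 5) - s 1%N).
Proof.
move=> i iN; rewrite !(coefD, coefN, coef_natM, coef_theta) coef_convolution //.
case: i iN => [|i] iN.
  by rewrite !coef0_sigma_series /conv big_geq //; ring.
by rewrite !coef_sigma_series // conv15 //; ring.
Qed.

Lemma vanish_conv33 : vanish N (120 * (s 3 * s 3) - s 7 + s 3).
Proof.
move=> i iN; rewrite !(coefD, coefN, coef_natM, coef_theta) coef_convolution //.
case: i iN => [|i] iN.
  by rewrite !coef0_sigma_series /conv big_geq //; ring.
by rewrite !coef_sigma_series // conv33 //; ring.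
Qed.

End Ramanujan.

(** * Eisenstein series and the discriminant *)

Section Niebur.

Variable N : nat.
Notation s := (sigma_series ^~ N).

Definition E2 : {poly rat} := 1 - 24 * s 1%N.
(* Only modulo 'X^N are [E4] and [E6] the usual series in sigma_3, sigma_5. *)
Definition E4 : {poly rat} := E2 ^+ 2 - 12 * theta E2.
Definition E6 : {poly rat} := E2 * E4 - 3 * theta E4.
Definition Delta1728 : {poly rat} := E4 ^+ 3 - E6 ^+ 2.
Definition chazy : {poly rat} :=
  2 * (E2 * theta (theta E2)) - 3 * theta E2 ^+ 2
  - 2 * theta (theta (theta E2)).

Lemma vanish_natM n (p : {poly rat}) : (0 < n)%N ->
  vanish N (n%:R * p) -> vanish N p.
Proof.
move=> n0 vp i /vp/eqP; rewrite coef_natM mulf_eq0 pnatr_eq0.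
by case/orP=> [|/eqP//]; rewrite eqn0Ngt n0.
Qed.

Lemma vanish_chazy : vanish N chazy.
Proof.
apply: (@vanish_natM 36) => //.
set a1 := 12 * (s 1%N * s 1%N) - 5 * s 3 - s 1%N + 6 * theta (s 1%N).
set a2 := 240 * (s 1%N * s 3) - 21 * s 5 - 10 * s 3
            + 30 * theta (s 3) + s 1%N.
set a3 := 504 * (s 1%N * s 5) - 20 * s 7 - 21 * s 5
            + 42 * theta (s 5) - s 1%N.
set a4 := 120 * (s 3 * s 3) - s 7 + s 3.
have v1 : vanish N a1 := @vanish_conv11 N.
have v2 : vanish N a2 := @vanish_conv13 N.
have v3 : vanish N a3 := @vanish_conv15 N.
have v4 : vanish N a4 := @vanish_conv33 N.
(* With P = [E2], Q = [1 + 240 * s 3] and R = [1 - 504 * s 5], one has [48 a1 = P^2 - 12 P' - Q],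
   [-24 a2 = P Q - 3 Q' - R] and [24 a3 - 480 a4 = P R - 2 R' - Q^2]. Eliminating Q and then R from
   the last expression leaves 36 times the Chazy expression; the other terms record these
   substitutions. *)
have -> : 36 * chazy =
    (E2 * (48 * E2) - 48 * (E4 + 1 + 240 * s 3)) * a1
    - (144 * E2) * theta a1 - (24 * E2) * a2
    - 96 * theta (E2 * a1) + 288 * theta (theta a1)
    + 48 * theta a2 + 24 * a3 - 480 * a4.
  by rewrite /chazy /a1 /a2 /a3 /a4 /E4 /E2 !thetaE; ring.
by do ![assumption | apply: vanishB | apply: vanishD | apply: vanishM
       | apply: vanish_theta].
Qed.

(** By definition [3 Q' = P Q - R], so [y' - P y] for [y = Q^3 - R^2] equals [R (P R - 2 R' - Q^2)],
    and the last factor is [36 * chazy]. *)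
Lemma logderiv_Delta1728 : logderiv N E2 Delta1728.
Proof.
have := vanishM (36 * E6) vanish_chazy; congr vanish.
by rewrite /chazy /Delta1728 /E6 /E4 !thetaE; ring.
Qed.

Definition product_series : {poly rat} :=
  'X * \prod_(1 <= k < N) (1 - 'X^k) ^+ 24.

Lemma logderiv_product : logderiv N E2 product_series.
Proof.
pose G := 1 + \sum_(1 <= k < N) 24 * - lambert rat N k.
have hG : logderiv N G product_series.
  apply: logderivM.
    rewrite /logderiv unlock derivX mul1r mulr1 subrr => i _.
    exact: coef0.
  rewrite big_nat [X in logderiv _ X _]big_nat.
  by apply: logderiv_prod => k /andP[k0 _]; apply/logderivX/logderiv_1BXn.
(* The Lambert series sum to the series of [sigma 1], but only below degree [N]. *)
have GE2 : vanish N (G - E2).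
  rewrite /G /E2 -mulr_sumr sumrN => i iN.
  rewrite !(coefB, coefD, coefN, coef_natM).
  case: i iN => [|i] iN; last first.
    by rewrite lambert_sum // coef_sigma_series //; ring.
  rewrite coef0_sigma_series coef_sum big1 => [|k _]; first by ring.
  by rewrite coef_poly if_same.
have := vanishD hG (vanishM product_series GE2); congr vanish; ring.
Qed.

Lemma product_series_Delta1728 : (1 < N)%N ->
  vanish N (1728 * product_series - Delta1728).
Proof.
move=> N1.
have coef1M (p q : {poly rat}) : (p * q)`_1 = p`_0 * q`_1 + p`_1 * q`_0.
  by rewrite coefM !big_ord_recl big_ord0 /= addr0.
have s1 : (s 1%N)`_1 = 1.
  by rewrite coef_sigma_series // ratsigmaE big_cons big_nil.
apply: (@vanish_ode E2).
- by rewrite /E2 coefB coef_natM coef0_sigma_series coef1 /=; ring.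
- rewrite coefB coef_natM /product_series coefXM mulr0.
  rewrite /Delta1728 /E6 /E4 /E2 !thetaE !exprS expr0 !mulr1.
  rewrite !(coef_natM, coef0M, coefD, coefN, coef_theta, coef1, coef0,
            coef0_sigma_series) /=.
  by ring.
(* The coefficients of [q] agree: the product has constant term 1, and [E4 = 1 + 240 q + ...],
   [E6 = 1 - 504 q + ...] give [3 * 240 + 2 * 504 = 1728]. *)
- rewrite coefB coef_natM /product_series coefXM /=.
  rewrite -horner_coef0 horner_prod big_nat big1 => [|k /andP[k0 _]]; last first.
    rewrite horner_exp hornerD hornerN hornerXn hornerC expr0n.
    by rewrite -[k == _]negbK -lt0n k0 subr0 expr1n.
  rewrite /Delta1728 /E6 /E4 /E2 !thetaE !exprS expr0 !mulr1.
  rewrite !(coef_natM, coef1M, coef0M, coefD, coefN, coef_theta, coef1, coef0,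
            coef0_sigma_series, s1) /=.
  by ring.
- have := vanishB (vanishM 1728 logderiv_product) logderiv_Delta1728.
  by congr vanish; rewrite !thetaE; ring.
Qed.

Notation theta := (@theta rat).

(** The generating series of the right-hand side of (i): [theta] on the first factor produces powers
    of [m], on the whole product powers of [n]. *)
Definition niebur_series : {poly rat} :=
  iter 4 theta (s 1%N)
  - 24 * (35 * (iter 4 theta (s 1%N) * s 1%N)
             - 52 * theta (iter 3 theta (s 1%N) * s 1%N)
             + 18 * theta (theta (iter 2 theta (s 1%N) * s 1%N))).

(** After substituting [s 1 = (1 - P) / 24] the terms linear in P cancel, as [35 - 52 + 18 = 1].
    What remains has weight 12 and [chazy] has weight 8, so the cofactors have weight 4. *)
Lemma niebur_series_Delta1728 :
  vanish N (1728 * niebur_series - Delta1728).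
Proof.
have v := vanish_chazy.
have -> : 1728 * niebur_series - Delta1728 =
    36 * (E2 ^+ 2 * chazy - (16 * theta E2) * chazy + E2 * theta chazy).
  by rewrite /niebur_series /Delta1728 /chazy /E6 /E4 /E2 /= !thetaE; ring.
by do ![assumption | apply: vanishB | apply: vanishD | apply: vanishM
       | apply: vanish_theta].
Qed.

Lemma niebur_series_product : (1 < N)%N ->
  vanish N (niebur_series - product_series).
Proof.
move=> N1; apply: (@vanish_natM 1728) => //.
have := vanishB niebur_series_Delta1728 (product_series_Delta1728 N1).
by congr vanish; ring.
Qed.

(* The relation by which the four formulas of the theorem differ. *)
Lemma vanish_sigma3_relation :
  vanish N (iter 4 theta (s 3) - iter 4 theta (s 1%N)
            + 96 * theta (iter 3 theta (s 1%N) * s 1%N)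
            - 72 * theta (theta (iter 2 theta (s 1%N) * s 1%N))).
Proof.
apply: (@vanish_natM 40) => //.
(* The second congruence brings in [s 3] with coefficient [8 * 5 = 40]; the first cancels its fifth
   derivative of [s 1]. *)
have := vanishB (vanish_theta (vanish_theta vanish_chazy))
  (vanishM 8 (vanish_theta (vanish_theta (vanish_theta (vanish_theta
    (@vanish_conv11 N)))))).
by congr vanish; rewrite /chazy /E2 /= !thetaE; ring.
Qed.

End Niebur.

(** * Comparison of coefficients *)

Lemma coef_product_series n : (product_series n.+1)`_n = (tau n)%:~R.
Proof.
rewrite /tau -coef_map /=; congr (_`_n).
rewrite /delta_trunc /product_series rmorphM /= map_polyX rmorph_prod.
congr ('X * _); apply: eq_bigr => k _.
by rewrite rmorphXn rmorphB rmorph1 /= map_polyXn.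
Qed.

Definition moment (j n : nat) : rat :=
  \sum_(1 <= m < n) m%:R ^+ j * (ratsigma 1 m * ratsigma 1 (n - m)).

Lemma tau_moments n : (0 < n)%N ->
  (tau n)%:~R = n%:R ^+ 4 * ratsigma 1 n
    - 24 * (35 * moment 4 n - 52 * (n%:R * moment 3 n)
            + 18 * (n%:R ^+ 2 * moment 2 n)).
Proof.
(* Order [n.+1] just retains the coefficient of degree [n], and [1 < n.+1] is [n0]. *)
move=> n0; have := @niebur_series_product n.+1 n0 n (ltnSn n).
rewrite coefB coef_product_series => /eqP; rewrite subr_eq0 => /eqP <-.
rewrite /niebur_series !(coefB, coefD, coef_natM).
rewrite coef_iter_theta !coef_theta !coef_sigma_seriesM //.
rewrite coef_sigma_series ?n0 /=//.
by rewrite /moment; ring.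
Qed.

Lemma sigma3_moments n : (0 < n)%N ->
  n%:R ^+ 4 * ratsigma 3 n = n%:R ^+ 4 * ratsigma 1 n
    - 96 * (n%:R * moment 3 n) + 72 * (n%:R ^+ 2 * moment 2 n).
Proof.
move=> n0; have := @vanish_sigma3_relation n.+1 n (ltnSn n).
rewrite !(coefD, coefN, coef_natM).
rewrite !coef_iter_theta !coef_theta !coef_sigma_seriesM //.
rewrite !coef_sigma_series ?n0 /=//.
by rewrite /moment; lra.
Qed.

Lemma sum_moments (c4 c3 c2 : rat) n (F : nat -> rat) :
    (forall m, F m = (c4 * m%:R ^+ 4 - c3 * m%:R ^+ 3 * n%:R
      + c2 * m%:R ^+ 2 * n%:R ^+ 2) * ratsigma 1 m * ratsigma 1 (n - m)) ->
  \sum_(1 <= m < n) F m = c4 * moment 4 n - c3 * (n%:R * moment 3 n)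
    + c2 * (n%:R ^+ 2 * moment 2 n).
Proof.
move=> eqF; rewrite !mulr_sumr -sumrB -big_split /=.
by apply: eq_bigr => m _; rewrite eqF; ring.
Qed.

Theorem theorem2p5 (n : nat) (hn : (1 <= n)%N) :
  let x : rat := n%:R in
  let t : rat := (tau n)%:~R in
  let s (k m : nat) : rat := (sigma k m)%:R in
  [/\ t = x ^+ 4 * s 1%N n
          - 24 * \sum_(1 <= m < n)
              (35 * m%:R ^+ 4 - 52 * m%:R ^+ 3 * x + 18 * m%:R ^+ 2 * x ^+ 2)
              * s 1%N m * s 1%N (n - m)%N,
      t = x ^+ 4 * (7 * s 1%N n - 6 * s 3%N n)
          - 168 * \sum_(1 <= m < n)
              (5 * m%:R ^+ 4 - 4 * m%:R ^+ 3 * x)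
              * s 1%N m * s 1%N (n - m)%N,
      t = x ^+ 4 * s 3%N n
          - 168 * \sum_(1 <= m < n)
              (5 * m%:R ^+ 4 - 8 * m%:R ^+ 3 * x + 3 * m%:R ^+ 2 * x ^+ 2)
              * s 1%N m * s 1%N (n - m)%N
    & t = x ^+ 4 / 3 * (7 * s 1%N n - 4 * s 3%N n)
          - 56 * \sum_(1 <= m < n)
              (15 * m%:R ^+ 4 - 20 * m%:R ^+ 3 * x + 6 * m%:R ^+ 2 * x ^+ 2)
              * s 1%N m * s 1%N (n - m)%N].
Proof.
have t0 := tau_moments hn; have t3 := sigma3_moments hn.
have sumE c4 c3 c2 := @sum_moments c4 c3 c2 n.
move=> x t s; rewrite /t {t} t0 /x /s -!/(ratsigma _ _) {x s}; split.
- by rewrite (sumE 35 52 18) // => m; rewrite /ratsigma; ring.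
(* Formulas (ii), (iii), (iv) arise from (i) by adding -6, 1 and -4/3 times the relation [t3], with
   all its terms moved to the left. *)
- rewrite (sumE 5 4 0) => [|m]; last by rewrite /ratsigma; ring.
  by lra.
- rewrite (sumE 5 8 3) => [|m]; last by rewrite /ratsigma; ring.
  by lra.
- rewrite (sumE 15 20 6) => [|m]; last by rewrite /ratsigma; ring.
  by lra.
Qed.
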